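(* Let $q=2$, $r\ge3$ and $m=2r$. Let $D=\{x\in\mathbb{F}_{2^m}:\mathrm{Tr}_{2^r/2}(x^{2^r+1})=0\}$ and $\overline{\mathcal{C}_D}=\{(\mathrm{Tr}_{2^m/2}(bx)+c)_{x\in D}: b\in\mathbb{F}_{2^m},\ c\in\mathbb{F}_2\}$. Then $\overline{\mathcal{C}_D}$ is a $(2^{r-1}(2^r-1),\ m+1,\ 2^{r-1}(2^{r-1}-1),\ 2;\ 3)$-LRC and $\overline{\mathcal{C}_D}^{\perp}$ is a $(2^{r-1}(2^r-1),\ 2^{r-1}(2^r-1)-m-1,\ 4,\ 2;\ 2^{r-1}(2^{r-1}-1)-1)$-LRC. In particular, $\overline{\mathcal{C}_D}^{\perp}$ is $k$-optimal or almost $k$-optimal.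
   Context: For an $[n,k,d]$ linear code $\mathcal{C}$ over $\mathbb{F}_q$ with coordinates indexed by $\{0,\dots,n-1\}$, coordinate $i$ has a repair set $R_i\subseteq\{0,\dots,n-1\}\setminus\{i\}$ of size $r$ if there is a function $f_i$ with $c_i=f_i(\mathbf{c}_{R_i})$ for all $\mathbf{c}\in\mathcal{C}$; the locality of $\mathcal{C}$ is the smallest $r$ such that every coordinate has a repair set of size $r$, and then $\mathcal{C}$ is called an $(n,k,d,q;r)$-LRC. The Cadambe–Mazumdar bound states $k\le\min_{t\in\mathbb{Z}^+}[rt+k^{(q)}_{opt}(n-t(r+1),d)]$, where $k^{(q)}_{opt}(n,d)$ is the largest dimension of a $q$-ary linear code of length $n$ and minimum distance $d$. An LRC is $k$-optimal if it meets this bound with equality, and almost $k$-optimal if $k$ equals the bound minus one. *)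

(* Defs.v *)
From HB Require Import structures.
From mathcomp Require Import all_boot all_order all_algebra all_field.
Set Implicit Arguments. Unset Strict Implicit. Unset Printing Implicit Defensive.
Import Order.TTheory GRing.Theory Num.Theory.
Local Open Scope ring_scope.

Section Codes.
Variable F : finFieldType.
Variable n : nat.
Implicit Types (C : {set 'rV[F]_n}) (c x y : 'rV[F]_n).

Definition wt c : nat := #|[set i : 'I_n | c 0 i != 0]|.

Definition is_lin C : bool :=
  [&& (0 : 'rV[F]_n) \in C,
      [forall x in C, forall y in C, x + y \in C] &
      [forall a : F, forall x in C, a *: x \in C]].

Definition dimC C : nat := \dim <<enum C>>%VS.

Definition has_min_dist C (d : nat) : bool :=
  [exists c in C, (c != 0) && (wt c == d)] &&
  [forall c in C, (c != 0) ==> (d <= wt c)%N].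

Definition restr (R : {set 'I_n}) c : 'rV[F]_n :=
  \row_j (if j \in R then c 0 j else 0).

Definition has_repair_set C (i : 'I_n) (r : nat) : Prop :=
  exists R : {set 'I_n}, [/\ i \notin R, #|R| = r &
    exists f : 'rV[F]_n -> F, forall c, c \in C -> c 0 i = f (restr R c)].

Definition all_repair C (r : nat) : Prop := forall i : 'I_n, has_repair_set C i r.

Definition locality C (r : nat) : Prop :=
  all_repair C r /\ forall r', (r' < r)%N -> ~ all_repair C r'.

(* C is an (n,k,d,q;r)-LRC (n is the length, i.e. the type index) *)
Definition is_LRC C (k d q r : nat) : Prop :=
  [/\ #|F| = q, is_lin C, dimC C = k, has_min_dist C d & locality C r].

Definition dual C : {set 'rV[F]_n} :=
  [set y : 'rV[F]_n | [forall x in C, \sum_(i < n) x 0 i * y 0 i == 0]].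

End Codes.

(* k_opt^{(q)}(n,d): largest dimension of a linear code over F (|F| = q) of
   length n and minimum distance d; 0 if no such code exists. *)
Definition kopt (F : finFieldType) (n d : nat) : nat :=
  \max_(k < n.+1 | [exists C : {set 'rV[F]_n},
                     [&& is_lin C, dimC C == k & has_min_dist C d]]) k.

(* term of the Cadambe--Mazumdar bound for a given t
   (lengths n - t(r+1) are truncated at 0) *)
Definition CM_term (F : finFieldType) (n d r t : nat) : nat :=
  (r * t + kopt F (n - t * (r + 1)) d)%N.

Definition k_optimal (F : finFieldType) (n k d r : nat) : Prop :=
  (forall t, (0 < t)%N -> (k <= CM_term F n d r t)%N) /\
  exists2 t, (0 < t)%N & k = CM_term F n d r t.

Definition almost_k_optimal (F : finFieldType) (n k d r : nat) : Prop :=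
  (forall t, (0 < t)%N -> (k.+1 <= CM_term F n d r t)%N) /\
  exists2 t, (0 < t)%N & k.+1 = CM_term F n d r t.

(* Tr_{2^s/2}(x) = sum_{i<s} x^(2^i), computed inside F *)
Definition Tr2 (F : fieldType) (s : nat) (x : F) : F :=
  \sum_(i < s) x ^+ (2 ^ i).

(* identification of the prime subfield {0,1} of F (char 2) with F_2 *)
Definition toF2 (F : fieldType) (a : F) : 'F_2 := (a != 0)%:R.

Definition Dset (F : finFieldType) (r : nat) : {set F} :=
  [set x : F | Tr2 r (x ^+ (2 ^ r + 1)) == 0].

Definition codeCD (F : finFieldType) (r : nat) : {set 'rV['F_2]_#|Dset F r|} :=
  [set \row_(j < #|Dset F r|) (toF2 (Tr2 (2 * r) (b * enum_val j)) + c)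
     | b : F, c : 'F_2].

(* Main.v *)
Require Import Defs.
From HB Require Import structures.
From mathcomp Require Import all_boot all_order all_algebra all_field.
From mathcomp Require Import mxabelem zify.

(* With Q = 2^r, the map f(x) = Tr_{2^r/2}(x^(Q+1)) is a quadratic form over F_2
   on F whose polarization Tr_{2^m/2}(x^Q y) is nondegenerate, and D is its zero
   set. The size of D is forced by counting roots: the nonzero x with f(x) = 0
   and the x with f(x) = 1 are roots of polynomials whose degrees add up to
   |F| - 1. Translating f by b gives the number of points of D on each
   hyperplane, hence the weights of the code. A word of the dual is a set of
   evenly many points of D with sum zero, so its weight is at least 4, and the
   hyperplane counts put every point of D in such a set of size 4.
   For a linear code, a repair set of size s exists at a coordinate only if the
   dual has a nonzero word of weight at most s + 1; so each locality is the dual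
   minimum distance minus one. In the Cadambe-Mazumdar bound, t = 1 leaves the
   length 2^(2r-2), where the extended Hamming code meets the sphere-packing
   bound; this exceeds the dimension by exactly one, and every t >= 2 gives at
   least as much, so the dual is in fact always almost k-optimal. *)

Set Implicit Arguments. Unset Strict Implicit. Unset Printing Implicit Defensive.
Import GRing.Theory.

(** * Linear codes, duality and repair sets *)

Section LinearCodes.
Local Open Scope ring_scope.
Variables (F : finFieldType) (n : nat).
Implicit Types (C : {set 'rV[F]_n}) (x y : 'rV[F]_n).

Lemma is_linP C :
  reflect [/\ 0 \in C, forall x y, x \in C -> y \in C -> x + y \in C
            & forall a x, x \in C -> a *: x \in C]
          (is_lin C).
Proof.
apply: (iffP and3P) => [[C0 /forallP CD /forallP CZ]|[C0 CD CZ]].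
  split=> // [x y Cx Cy|a x Cx].
    by have /implyP/(_ Cx)/forallP/(_ y)/implyP/(_ Cy) := CD x.
  by have /forallP/(_ x)/implyP/(_ Cx) := CZ a.
split=> //.
  by apply/forallP=> x; apply/implyP=> Cx; apply/forallP=> y; apply/implyP=> Cy; apply: CD.
by apply/forallP=> a; apply/forallP=> x; apply/implyP=> Cx; apply: CZ.
Qed.

Lemma lin_sum C (I : finType) (a : I -> F) (v : I -> 'rV[F]_n) :
  is_lin C -> (forall i, v i \in C) -> \sum_i a i *: v i \in C.
Proof.
case/is_linP=> C0 CD CZ Cv; apply: (big_ind (fun x => x \in C)) => // i _.
exact: CZ.
Qed.

(** Listing every codeword as a row makes rank and kernel results for matrices available for codes
    given as sets. *)
Definition gen_mx C : 'M[F]_(#|C|, n) := \matrix_i enum_val i.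

Lemma lin_rowg C : is_lin C -> rowg (gen_mx C) = C.
Proof.
move=> linC; apply/setP=> v; rewrite inE; apply/idP/idP=> [/submxP[w ->]|Cv].
  rewrite mulmx_sum_row; apply: lin_sum => // i.
  by rewrite rowK enum_valP.
rewrite -(enum_rankK_in Cv Cv); set i := enum_rank_in _ _.
by rewrite -(rowK (fun i => enum_val i) i) row_sub.
Qed.

Lemma card_lin C : is_lin C -> #|C| = (#|F| ^ dimC C)%N.
Proof.
move=> linC; rewrite /dimC -card_vspace; apply: eq_card => v.
apply/idP/idP=> [Cv|]; first by apply: memv_span; rewrite mem_enum.
move=> /(@coord_span _ _ _ (in_tuple (enum C)))->; apply: lin_sum => // i.
by rewrite -mem_enum mem_nth.
Qed.

Lemma rank_gen_mx C : is_lin C -> \rank (gen_mx C) = dimC C.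
Proof.
move=> linC; apply/eqP; rewrite -(@eqn_exp2l #|F|) ?finRing_gt1 //.
by rewrite -card_rowg lin_rowg // card_lin.
Qed.

Lemma dual_dot C x y : x \in C -> y \in dual C -> \sum_i x 0 i * y 0 i = 0.
Proof. by move=> Cx; rewrite inE => /forallP/(_ x)/implyP/(_ Cx)/eqP. Qed.

Lemma in_dual C y :
  (forall x, x \in C -> \sum_i x 0 i * y 0 i = 0) -> y \in dual C.
Proof.
by move=> H; rewrite inE; apply/forallP=> x; apply/implyP=> Cx; apply/eqP/H.
Qed.

Lemma is_lin_dual C : is_lin (dual C).
Proof.
apply/is_linP; split=> [|x y Dx Dy|a x Dx]; apply: in_dual => c Cc.
- by rewrite big1 // => i _; rewrite mxE mulr0.
- under eq_bigr do rewrite mxE mulrDr.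
  by rewrite big_split /= !(dual_dot Cc) ?addr0.
- under eq_bigr do rewrite mxE mulrCA.
  by rewrite -mulr_sumr (dual_dot Cc) ?mulr0.
Qed.

Lemma dual_rowg C : dual C = rowg (kermx (gen_mx C)^T).
Proof.
apply/setP=> y; rewrite [RHS]inE; apply/idP/idP=> [Dy|/sub_kermxP yG].
  apply/sub_kermxP/rowP=> i; rewrite !mxE -[RHS](dual_dot (enum_valP i) Dy).
  by apply: eq_bigr => j _; rewrite !mxE mulrC.
apply: in_dual => x Cx.
have /rowP/(_ (enum_rank_in Cx x)) := yG; rewrite !mxE => e; rewrite -[RHS]e.
by apply: eq_bigr => j _; rewrite !mxE enum_rankK_in // mulrC.
Qed.

Lemma dimC_dual C : is_lin C -> dimC (dual C) = (n - dimC C)%N.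
Proof.
move=> linC; apply/eqP; rewrite -(@eqn_exp2l #|F|) ?finRing_gt1 //.
rewrite -card_lin ?is_lin_dual // dual_rowg card_rowg mxrank_ker mxrank_tr.
by rewrite rank_gen_mx.
Qed.

(** The columns of the cokernel matrix of [gen_mx C] are dual words, and a vector outside the row
    space has a nonzero product with one of them. *)
Lemma dual_separates C x :
  is_lin C -> x \notin C -> exists2 y, y \in dual C & \sum_i x 0 i * y 0 i != 0.
Proof.
move=> linC; rewrite -{1}(lin_rowg linC) mem_rowg submxE => nz.
have [j xj] : exists j, (x *m cokermx (gen_mx C)) 0 j != 0.
  apply/existsP; apply: contraR nz => /existsPn nj.
  by apply/eqP/rowP=> j; rewrite [RHS]mxE; apply/eqP; rewrite -[_ == _]negbK nj.
exists (\row_i cokermx (gen_mx C) i j); last first.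
  by rewrite mxE in xj; under eq_bigr do rewrite mxE.
apply: in_dual => c Cc; under eq_bigr do rewrite mxE.
have : (c *m cokermx (gen_mx C)) = 0.
  by apply/eqP; rewrite -submxE -mem_rowg lin_rowg.
by move/rowP/(_ j); rewrite !mxE.
Qed.

Lemma dualK C : is_lin C -> dual (dual C) = C.
Proof.
move=> linC; apply/setP=> x; apply/idP/idP=> [DDx|Cx].
  apply/negPn/negP=> /(dual_separates linC)[y Dy /eqP[]].
  by rewrite -[RHS](dual_dot Dy DDx); apply: eq_bigr => i _; rewrite mulrC.
apply: in_dual => y Dy; rewrite -[RHS](dual_dot Cx Dy).
by apply: eq_bigr => i _; rewrite mulrC.
Qed.

(** A dual word is a parity check; solving it for coordinate [i] uses only the rest of its
    support. *)
Lemma repair_of_dual_word C (i : 'I_n) y :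
  y \in dual C -> y 0 i != 0 -> has_repair_set C i (wt y).-1.
Proof.
move=> Dy yi; pose S := [set j | y 0 j != 0].
have iS : i \in S by rewrite inE.
exists (S :\ i); split; first by rewrite !inE eqxx.
  by rewrite /wt (cardsD1 i S) iS.
exists (fun c => - (\sum_(j | j != i) c 0 j * y 0 j) / y 0 i) => c Cc.
have := dual_dot Cc Dy; rewrite (bigD1 i) //= => /eqP.
rewrite addr_eq0 => /eqP e; apply: (mulIf yi); rewrite divfK // e; congr (- _).
apply: eq_bigr => j ji; rewrite mxE !inE ji /=.
by have [->|] := eqVneq (y 0 j) 0; rewrite ?mulr0.
Qed.

(* If no nonzero dual word were supported on R and i, then duality for the
   code C + <e_j : j in R> would produce a word of C vanishing on R but not
   at i. *)
Lemma dual_word_of_repair C (i : 'I_n) r :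
  is_lin C -> has_repair_set C i r ->
  exists y, [/\ y \in dual C, y != 0 & (wt y <= r.+1)%N].
Proof.
move=> linC [R [iR cR [f fP]]].
have [D0 DD DZ] := is_linP _ (is_lin_dual C).
(* [E] is the dual of [C] enlarged by all vectors supported on [R], so a word orthogonal to [E] lies
   in [C] and vanishes on [R]. *)
pose E := [set x | [exists y in dual C, restr (~: R) x == restr (~: R) y]].
have restrE (A : {set 'I_n}) x y :
    reflect (forall j, j \in A -> x 0 j = y 0 j) (restr A x == restr A y).
  apply: (iffP eqP) => [e j jA|e].
    by have /rowP/(_ j) := e; rewrite !mxE jA.
  by apply/rowP=> j; rewrite !mxE; case: ifP => // /e.
have EP x : reflect (exists2 y, y \in dual C & forall j, j \notin R -> x 0 j = y 0 j)
                    (x \in E).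
  rewrite inE; apply: (iffP existsP) => [[y /andP[Dy /restrE e]]|[y Dy e]].
    by exists y => // j jR; apply: e; rewrite inE.
  by exists y; rewrite Dy; apply/restrE => j; rewrite inE; apply: e.
have linE : is_lin E.
  apply/is_linP; split=> [|x y /EP[u Du xu] /EP[v Dv yv]|a x /EP[u Du xu]]; apply/EP.
  - by exists 0.
  - by exists (u + v); [apply: DD | move=> j jR; rewrite !mxE xu ?yv].
  - by exists (a *: u); [apply: DZ | move=> j jR; rewrite !mxE xu].
have ei : delta_mx 0 i \in E.
  apply/negPn/negP=> /(dual_separates linE)[c Dc].
  rewrite (bigD1 i) //= big1 => [|j /negPf ji]; last by rewrite mxE eqxx ji mul0r.
  rewrite mxE !eqxx mul1r addr0 => /eqP[].
  have Cc : c \in C.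
    rewrite -(dualK linC); apply: in_dual => y Dy.
    by apply: dual_dot Dc; apply/EP; exists y.
  (* On [R] the word [c] agrees with the zero codeword, so the repair function returns the same
     value for both. *)
  have -> : c 0 i = (0 : 'rV[F]_n) 0 i; last by rewrite mxE.
  have [C0 _ _] := is_linP _ linC; rewrite !fP //; congr (f _).
  apply/rowP=> j; rewrite !mxE; case: ifP => // jR.
  have ej : delta_mx 0 j \in E.
    apply/EP; exists 0 => // k kR; rewrite !mxE eqxx /=.
    by case: eqP => // ek; case/negP: kR; rewrite ek.
  have := dual_dot ej Dc; rewrite (bigD1 j) //= big1 => [|k /negPf kj].
    by rewrite mxE !eqxx mul1r addr0.
  by rewrite mxE eqxx kj mul0r.
case/EP: ei => y Dy yE; exists y; split=> //.
  apply/eqP=> y0; have := yE i iR; rewrite y0 !mxE !eqxx => /eqP.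
  by rewrite oner_eq0.
have -> : r.+1 = #|i |: R| by rewrite cardsU1 iR cR.
apply: subset_leq_card; apply/subsetP=> j; rewrite !inE; apply: contraNT.
by rewrite negb_or => /andP[/negPf ji jR]; rewrite -yE // !mxE ji.
Qed.

Lemma locality_dual_dist C d :
  (0 < n)%N -> is_lin C ->
  (forall y, y \in dual C -> y != 0 -> (d <= wt y)%N) ->
  (forall i, exists y, [/\ y \in dual C, y 0 i != 0 & wt y = d]) ->
  locality C d.-1.
Proof.
move=> n0 linC lb cov; split=> [i|r lt_rd rep].
  by have [y [Dy yi <-]] := cov i; apply: repair_of_dual_word.
(* Since the length is positive, there is a coordinate at which to refute a smaller repair set. *)
have [y [Dy y0 le]] := dual_word_of_repair linC (rep (Ordinal n0)).
by have := lb y Dy y0; lia.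
Qed.

Lemma has_min_distP C d :
  reflect ((exists c, [/\ c \in C, c != 0 & wt c = d]) /\
           (forall c, c \in C -> c != 0 -> (d <= wt c)%N))
          (has_min_dist C d).
Proof.
apply: (iffP andP) => [[/existsP[c /and3P[Cc c0 /eqP cd]] /forallP H]|[[c [Cc c0 cd]] H]].
  split; first by exists c.
  by move=> x Cx; have /implyP/(_ Cx)/implyP := H x.
split; first by apply/existsP; exists c; rewrite Cc c0 cd eqxx.
by apply/forallP=> x; apply/implyP=> Cx; apply/implyP; apply: H.
Qed.

Lemma has_min_dist_cover C d :
  (0 < n)%N ->
  (forall y, y \in C -> y != 0 -> (d <= wt y)%N) ->
  (forall i, exists y, [/\ y \in C, y 0 i != 0 & wt y = d]) ->
  has_min_dist C d.
Proof.
move=> n0 lb cov; apply/has_min_distP; split=> //.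
have [y [Cy yi yd]] := cov (Ordinal n0); exists y; split=> //.
by apply: contraNneq yi => ->; rewrite mxE.
Qed.

End LinearCodes.

(** * Arithmetic in the two-element field *)

Section BinaryField.
Local Open Scope ring_scope.

Lemma F2P (a : 'F_2) : a = 0 \/ a = 1.
Proof.
case: a => [[|[|m]] lt_m]; [by left; apply/val_inj | by right; apply/val_inj |].
by have : (m.+2 < 2)%N := lt_m.
Qed.

Lemma F2E (a : 'F_2) : a = (a != 0)%:R.
Proof. by case: (F2P a) => ->. Qed.

Lemma F2_addxx (a : 'F_2) : a + a = 0.
Proof. by case: (F2P a) => ->; apply/val_inj. Qed.

Lemma F2_addr_eq0 (a b : 'F_2) : (a + b == 0) = ((a == 0) == (b == 0)).
Proof. by case: (F2P a) => ->; case: (F2P b) => ->. Qed.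

Lemma F2_natr_eq0 k : (k%:R == 0 :> 'F_2) = ~~ odd k.
Proof.
elim: k => [|k IH]; first by rewrite eqxx.
by rewrite -natr1 F2_addr_eq0 IH oner_eq0 /=; case: (odd k).
Qed.

End BinaryField.

(** * Binary codes of affine functions on a finite point set *)

Section PairingCode.
Local Open Scope ring_scope.
Variables (U V : finZmodType) (h : U -> V -> 'F_2).
Hypothesis hDl : forall u u' v, h (u + u') v = h u v + h u' v.
Hypothesis hDr : forall u v v', h u (v + v') = h u v + h u v'.
Hypothesis h_sep : forall v, (forall u, h u v = 0) -> v = 0.
Variables (n : nat) (p : 'I_n -> V).
Hypothesis p_inj : injective p.

(** A common form for the trace code and for the dual of the extended Hamming code. *)
Definition pcode : {set 'rV['F_2]_n} :=
  [set \row_j (h u (p j) + c) | u : U, c : 'F_2].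

Let word u (c : 'F_2) : 'rV['F_2]_n := \row_j (h u (p j) + c).

Lemma pcodeP x : reflect (exists u c, x = word u c) (x \in pcode).
Proof.
apply: (iffP imset2P) => [[u c _ _ ->]|[u [c ->]]]; first by exists u, c.
by exists u c.
Qed.

Lemma pairing0l v : h 0 v = 0.
Proof. by apply: (addrI (h 0 v)); rewrite -hDl !addr0. Qed.

Lemma pairing0r u : h u 0 = 0.
Proof. by apply: (addrI (h u 0)); rewrite -hDr !addr0. Qed.

Lemma pairing_char2 (v : V) : v + v = 0.
Proof. by apply: h_sep => u; rewrite hDr F2_addxx. Qed.

Lemma is_lin_pcode : is_lin pcode.
Proof.
apply/is_linP; split.
- by apply/pcodeP; exists 0, 0; apply/rowP=> j; rewrite !mxE pairing0l addr0.
- move=> _ _ /pcodeP[u [c ->]] /pcodeP[u' [c' ->]]; apply/pcodeP.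
  by exists (u + u'), (c + c'); apply/rowP=> j; rewrite !mxE hDl addrACA.
- move=> a _ /pcodeP[u [c ->]]; apply/pcodeP; rewrite [a]F2E.
  case: (a != 0); first by exists u, c; rewrite scale1r.
  by exists 0, 0; rewrite scale0r; apply/rowP=> j; rewrite !mxE pairing0l addr0.
Qed.

Lemma pcode_imset : pcode = [set word uc.1 uc.2 | uc in [set: U * 'F_2]].
Proof.
apply/setP=> x; apply/pcodeP/imsetP=> [[u [c ->]]|[[u c] _ ->]].
  by exists (u, c).
by exists u, c.
Qed.

Lemma card_pcode_leq : (#|pcode| <= #|U| * 2)%N.
Proof.
rewrite pcode_imset; apply: leq_trans (leq_imset_card _ _) _.
by rewrite cardsT card_prod card_Fp.
Qed.

Lemma card_pcode :
  (forall u c, word u c = 0 -> u = 0 /\ c = 0) -> #|pcode| = (#|U| * 2)%N.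
Proof.
move=> ker; rewrite pcode_imset card_imset ?cardsT ?card_prod ?card_Fp //.
move=> [u c] [u' c'] /= e.
have [] := ker (u - u') (c - c').
  apply/rowP=> j; rewrite !mxE; apply: (addIr (h u' (p j) + c')).
  rewrite add0r addrACA -hDl !subrK.
  by have /rowP/(_ j) := e; rewrite !mxE.
by move=> /subr0_eq-> /subr0_eq->.
Qed.

(** A binary word is determined by its support, so dual words can be handled as sets of
    coordinates. *)
Definition ind (S : {set 'I_n}) : 'rV['F_2]_n := \row_j (j \in S)%:R.

Lemma ind_supp (y : 'rV['F_2]_n) : y = ind [set j | y 0 j != 0].
Proof. by apply/rowP=> j; rewrite mxE inE -F2E. Qed.

Lemma wt_ind S : wt (ind S) = #|S|.
Proof. by apply: eq_card => j; rewrite inE mxE; case: (j \in S). Qed.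

Lemma word_dot_ind u c S :
  \sum_j word u c 0 j * ind S 0 j = h u (\sum_(j in S) p j) + c *+ #|S|.
Proof.
rewrite (big_morph (h u) (hDr u) (pairing0r u)) -sumr_const -big_split /=.
rewrite [RHS]big_mkcond /=; apply: eq_bigr => j _; rewrite !mxE.
by case: (j \in S); rewrite ?mulr1 ?mulr0.
Qed.

(** Orthogonality to the constant word gives even size; orthogonality to the words with [c = 0]
    gives zero sum, by [h_sep]. *)
Lemma ind_dual_pcode S :
  (ind S \in dual pcode) = ~~ odd #|S| && (\sum_(j in S) p j == 0).
Proof.
apply/idP/andP=> [D|[S2 /eqP S0]]; last first.
  apply: in_dual => _ /pcodeP[u [c ->]].
  rewrite word_dot_ind S0 pairing0r add0r -mulr_natr.
  by move: S2; rewrite -F2_natr_eq0 => /eqP->; rewrite mulr0.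
have dot u c : h u (\sum_(j in S) p j) + c *+ #|S| = 0.
  by rewrite -word_dot_ind; apply: dual_dot D; apply/pcodeP; exists u, c.
split; first by rewrite -F2_natr_eq0; have := dot 0 1; rewrite pairing0l add0r => ->.
by apply/eqP/h_sep=> u; have := dot u 0; rewrite mul0rn addr0.
Qed.

(** The weight is even and nonzero, and it is not 2 because two points with zero sum coincide in
    characteristic 2. *)
Lemma dual_pcode_wt y : y \in dual pcode -> y != 0 -> (4 <= wt y)%N.
Proof.
rewrite [y]ind_supp; set S := [set _ | _].
rewrite ind_dual_pcode wt_ind => /andP[S2 /eqP S0] nz.
have : #|S| != 0%N.
  by apply: contraNneq nz => /cards0_eq->; apply/eqP/rowP=> j; rewrite !mxE inE.
have : #|S| != 2%N.
  apply/negP=> /cards2P[i [j [ij eS]]]; move: S0.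
  rewrite eS big_setU1 ?inE //= big_set1 => e.
  by case/eqP: ij; apply: p_inj; apply: (addIr (p j)); rewrite e pairing_char2.
by case: #|S| S2 => [|[|[|[|m]]]].
Qed.

Lemma dual_pcode_cover :
  (forall i, exists j k, [/\ i != j, i != k, j != k &
      exists l, p l = p i + p j + p k]) ->
  forall i, exists y, [/\ y \in dual pcode, y 0 i != 0 & wt y = 4%N].
Proof.
move=> H i; have [j [k [ij ik jk [l el]]]] := H i.
(* If [a = b] the relation leaves [p c + p d = 0], hence [c = d]; this makes the fourth point differ
   from the other three. *)
have neq (a b c d : 'I_n) : p a = p b + p c + p d -> c != d -> b != a.
  move=> e; apply: contraNneq => ba; rewrite -{a}ba in e; apply/eqP/p_inj.
  have : p c + p d = 0 by apply: (addrI (p b)); rewrite addrA -e addr0.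
  by move=> cd; apply: (addIr (p d)); rewrite cd pairing_char2.
have il := neq _ _ _ _ el jk.
have jl : j != l by apply: (neq l j i k) => //; rewrite el (addrC (p j)).
have kl : k != l by apply: (neq l k i j) => //; rewrite el -[RHS]addrA [RHS]addrC.
pose S := i |: (j |: (k |: [set l])).
have iS : i \notin j |: (k |: [set l]) by rewrite !inE !negb_or ij ik il.
have jS : j \notin k |: [set l] by rewrite !inE !negb_or jk jl.
have kS : k \notin [set l] by rewrite inE.
have S4 : #|S| = 4%N by rewrite !cardsU1 cards1 iS jS kS.
exists (ind S); split; last by rewrite wt_ind.
  rewrite ind_dual_pcode S4 /= !big_setU1 //= big_set1 !addrA.
  by rewrite -el pairing_char2.
by rewrite mxE !inE eqxx oner_eq0.
Qed.

End PairingCode.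

Lemma card_ltn_ex (T : finType) (A B : {set T}) :
  #|B| < #|A| -> exists2 x, x \in A & x \notin B.
Proof.
move=> lt; apply/subsetPn; apply/negP=> /subset_leq_card; lia.
Qed.

(** * Largest dimension of binary codes of length 2^s and distance 4 *)

Section BinaryBounds.
Local Open Scope ring_scope.

(* For a code of minimum distance 4, the vectors c + e_j + a e_0 determine
   c, j and a. *)
Lemma sphere_packing4 n (C : {set 'rV['F_2]_n.+1}) :
  is_lin C -> has_min_dist C 4 -> (#|C| * n.+1 * 2 <= 2 ^ n.+1)%N.
Proof.
move=> /is_linP[C0 CD CZ] /has_min_distP[_ dC].
pose e (j : 'I_n.+1) : 'rV['F_2]_n.+1 := delta_mx 0 j.
pose g (t : 'rV['F_2]_n.+1 * 'I_n.+1 * 'F_2) := t.1.1 + e t.1.2 + t.2 *: e 0.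
have eE j k : e j 0 k = (k == j)%:R by rewrite mxE eqxx.
have injg : {in setX (setX C setT) setT &, injective g}.
  move=> [[c j] a] [[c' j'] a']; rewrite !inE /= !andbT => Cc Cc' /rowP eg.
  have {}eg k : c 0 k + (k == j)%:R + a * (k == 0)%:R
              = c' 0 k + (k == j')%:R + a' * (k == 0)%:R.
    by have := eg k; rewrite /g /= !mxE !eqxx.
  have cc' : c = c'.
    apply/eqP; rewrite -subr_eq0; apply: contraTT isT => nz.
    have Cd : c - c' \in C by apply: CD => //; rewrite -scaleN1r; apply: CZ.
    have := dC _ Cd nz; rewrite leqNgt => /negP[].
    (* The difference of the two codewords is supported on 0, [j] and [j'], hence has weight at most
       3. *)
    apply: (@leq_ltn_trans #|[set 0; j] :|: [set j']|); last first.
      rewrite cardsU cards1 cards2; lia.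
    apply: subset_leq_card; apply/subsetP=> k; rewrite !inE; apply: contraNT.
    rewrite !negb_or => /andP[/andP[/negPf k0 /negPf kj] /negPf kj'].
    by have := eg k; rewrite k0 kj kj' !mulr0 !addr0 !mxE => ->; rewrite subrr.
  subst c'; have {}eg k : (k == j)%:R + a * (k == 0)%:R
              = (k == j')%:R + a' * (k == 0)%:R :> 'F_2.
    by apply: (addrI (c 0 k)); rewrite !addrA.
  have jj' : j = j'.
    apply/eqP; apply/negPn/negP => jj'.
    (* The unknown scalars sit at coordinate 0, so the comparison is made at whichever of [j], [j']
       is nonzero. *)
    have [j0|j0] := eqVneq j 0.
      have := eg j'; rewrite eqxx eq_sym (negPf jj') -j0 eq_sym (negPf jj').
      by rewrite !mulr0 !addr0 => /eqP; rewrite eq_sym oner_eq0.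
    have := eg j; rewrite eqxx (negPf jj') (negPf j0) !mulr0 !addr0 => /eqP.
    by rewrite oner_eq0.
  by subst j'; have /addrI := eg 0; rewrite eqxx !mulr1 => ->.
have <- : #|setX (setX C [set: 'I_n.+1]) [set: 'F_2]| = (#|C| * n.+1 * 2)%N.
  by rewrite !cardsX !cardsT card_ord card_Fp.
rewrite -(card_in_imset injg); apply: leq_trans (max_card _) _.
by rewrite card_mx card_Fp // mul1n.
Qed.

(** Comparing exponents in the sphere-packing bound gives [k + s + 1 <= 2 ^ s]. *)
Lemma kopt4_leq s : (kopt 'F_2 (2 ^ s) 4 <= 2 ^ s - s - 1)%N.
Proof.
apply/bigmax_leqP=> k /existsP[C /and3P[linC /eqP dimk dC]].
have e : (2 ^ s)%N = (2 ^ s).-1.+1 by rewrite prednK // expn_gt0.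
have : (#|C| * 2 ^ s * 2 <= 2 ^ (2 ^ s))%N.
  move: C linC dC {dimk}; rewrite e => C linC dC.
  exact: sphere_packing4.
rewrite card_lin // dimk card_Fp // -expnD -expnSr leq_exp2l //; lia.
Qed.

Lemma kopt_geq (F : finFieldType) n d (C : {set 'rV[F]_n}) :
  is_lin C -> has_min_dist C d -> (dimC C <= kopt F n d)%N.
Proof.
move=> linC dC.
have lt : (dimC C < n.+1)%N.
  rewrite ltnS -(@leq_exp2l #|F|) ?finRing_gt1 // -card_lin //.
  by apply: leq_trans (max_card _) _; rewrite card_mx mul1n.
apply: (@leq_bigmax_cond _ _ (fun k : 'I_n.+1 => k : nat) (Ordinal lt)).
by apply/existsP; exists C; rewrite linC dC /= eqxx.
Qed.

(* The extended Hamming code: the dual of the affine functions on F_2^s. *)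
Lemma kopt4_geq s : (2 <= s)%N -> (2 ^ s - s - 1 <= kopt 'F_2 (2 ^ s) 4)%N.
Proof.
move=> s2; pose V := 'rV['F_2]_s.
have cV : #|V| = (2 ^ s)%N by rewrite card_mx card_Fp // mul1n.
pose h (u v : V) : 'F_2 := \sum_i u 0 i * v 0 i.
have hDl u u' v : h (u + u') v = h u v + h u' v.
  by rewrite -big_split; apply: eq_bigr => i _; rewrite mxE mulrDl.
have hDr u v v' : h u (v + v') = h u v + h u v'.
  by rewrite -big_split; apply: eq_bigr => i _; rewrite mxE mulrDr.
have h_sep v : (forall u, h u v = 0) -> v = 0.
  move=> hv; apply/rowP=> i; have := hv (delta_mx 0 i).
  rewrite /h (bigD1 i) //= big1 => [|j /negPf ji]; rewrite !mxE eqxx.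
    by rewrite eqxx mul1r addr0.
  by rewrite ji mul0r.
pose p (j : 'I_#|V|) : V := enum_val j.
have p_inj : injective p := @enum_val_inj _ _.
have n4 : (4 <= #|V|)%N by rewrite cV (leq_pexp2l (isT : 0 < 2)%N s2).
have lin := is_lin_pcode hDl p.
have wt4 := dual_pcode_wt hDl hDr h_sep p_inj.
(* An upper bound is enough here, as it becomes a lower bound for the dimension of the dual. *)
have dim : (dimC (pcode h p) <= s.+1)%N.
  rewrite -(@leq_exp2l 2) // -{1}(card_Fp (isT : prime 2)) -card_lin //.
  by apply: leq_trans (card_pcode_leq _ _) _; rewrite cV expnSr.
(* All vectors are points, so the sum of any three points is again a point. *)
have cover i : exists j k, [/\ i != j, i != k, j != k &
    exists l, p l = p i + p j + p k].
  have [|j _ ji] := @card_ltn_ex _ [set: 'I_#|V|] [set i].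
    by rewrite cards1 cardsT card_ord; lia.
  have [|k _ ki] := @card_ltn_ex _ [set: 'I_#|V|] [set i; j].
    by rewrite cards2 cardsT card_ord; lia.
  move: ji ki; rewrite !inE negb_or ![_ == i]eq_sym [k == j]eq_sym.
  move=> ij /andP[ik jk]; exists j, k; split=> //.
  by exists (enum_rank (p i + p j + p k)); rewrite /p enum_rankK.
have {}cover := dual_pcode_cover hDl hDr h_sep p_inj cover.
have dC : has_min_dist (dual (pcode h p)) 4.
  by apply: has_min_dist_cover => //; lia.
rewrite -cV; apply: leq_trans (kopt_geq (is_lin_dual _) dC).
rewrite dimC_dual //; lia.
Qed.

End BinaryBounds.

(** * The code on the zero set of a nondegenerate quadratic form *)

Section QuadraticForm.
Local Open Scope ring_scope.
Variables (V : finZmodType) (f : V -> 'F_2) (B : V -> V -> 'F_2).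
Hypothesis fD : forall x y, f (x + y) = f x + f y + B x y.
Hypothesis BDl : forall x x' y, B (x + x') y = B x y + B x' y.
Hypothesis B_nondeg : forall x, (forall y, B x y = 0) -> x = 0.
(** In the application [q] is 2^(r-1); the cardinalities below are those of an elliptic quadric in a
    space of (2q)^2 vectors. *)
Variables (D : {set V}) (q : nat).
Hypothesis memD : forall x, (x \in D) = (f x == 0).
Hypothesis q_ge4 : (4 <= q)%N.
Hypothesis cardV : #|V| = (4 * (q * q))%N.
Hypothesis cardD : #|D| = (q * (2 * q - 1))%N.

Let pt (j : 'I_#|D|) : V := enum_val j.
Definition qcode : {set 'rV['F_2]_#|D|} := pcode B pt.
Let word b (c : 'F_2) : 'rV['F_2]_#|D| := \row_j (B b (pt j) + c).

Let BC x y : B x y = B y x.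
Proof.
by apply: (addrI (f x + f y)); rewrite -fD addrC fD [f y + _]addrC.
Qed.

Let BDr x y y' : B x (y + y') = B x y + B x y'.
Proof. by rewrite !(BC x) BDl. Qed.

Let B_sep v : (forall u, B u v = 0) -> v = 0.
Proof. by move=> Bv; apply: B_nondeg => u; rewrite BC. Qed.

Let charV (x : V) : x + x = 0.
Proof. exact: pairing_char2 BDr B_sep x. Qed.

Let addKV (x : V) : involutive (+%R x).
Proof. by move=> y; rewrite addrA charV add0r. Qed.

Let f0 : f 0 = 0.
Proof. by have := fD 0 0; rewrite addr0 F2_addxx add0r => ->; apply: pairing0l. Qed.

Let Bxx x : B x x = 0.
Proof. by have := fD x x; rewrite charV f0 F2_addxx add0r => <-. Qed.

Let pt_inj : injective pt.
Proof. exact: enum_val_inj. Qed.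

Let fpt j : f (pt j) = 0.
Proof. by apply/eqP; rewrite -memD enum_valP. Qed.

Let pt_onto x : f x = 0 -> exists j, pt j = x.
Proof.
move=> fx; have Dx : x \in D by rewrite memD fx.
by exists (enum_rank_in Dx x); rewrite /pt enum_rankK_in.
Qed.

Lemma card_shift (A : {set V}) x : #|[set y | x + y \in A]| = #|A|.
Proof.
rewrite -[RHS](card_imset _ (addrI x)) (can2_imset_pre _ (addKV x) (addKV x)).
by apply: eq_card => y; rewrite !inE.
Qed.

(** Translation by a vector [x] with [B b x] nonzero exchanges the hyperplane and its complement. *)
Lemma card_hyperplane b : b != 0 -> #|[set x | B b x == 0%R]| = (2 * (q * q))%N.
Proof.
move=> b0; set A := [set x | _].
have [x Bbx] : exists x, B b x != 0.
  apply/existsP; apply: contraNT b0 => /existsPn Bb0.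
  by apply/eqP/B_nondeg => x; apply/eqP; rewrite -[_ == _]negbK.
have AC : #|~: A| = #|A|.
  rewrite -(card_shift A x); apply: eq_card => y; rewrite !inE BDr F2_addr_eq0.
  by rewrite (negPf Bbx); case: eqP.
have := cardsC A; rewrite AC cardV; lia.
Qed.

Let cardDq : (#|D| + q = 2 * (q * q))%N.
Proof. by rewrite cardD; nia. Qed.

(* The complement of the symmetric difference of D and the hyperplane is a
   translate of D or of its complement, since f + B b = f (b + _) + f b. *)
Lemma card_quadric_hyperplane b : b != 0 ->
  #|D :&: [set x | B b x == 0%R]| = (if f b == 0%R then q * (q - 1) else q * q)%N.
Proof.
move=> b0; have := card_hyperplane b0; set A := [set x | _] => cA.
pose E := [set x | f x + B b x == 0].
have cE : #|E| = (if f b == 0%R then #|D| else #|V| - #|D|)%N.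
  have EE : E = [set x | b + x \in (if f b == 0 then D else ~: D)].
    apply/setP=> x; case: ifP => fb; rewrite !inE memD fD -addrA [in RHS]F2_addr_eq0 fb;
      by case: (_ == 0).
  by rewrite EE card_shift; case: ifP => // _; rewrite cardsCs setCK.
have ED : E :&: D = D :&: A.
  apply/setP=> x; rewrite !inE memD F2_addr_eq0 andbC.
  by case: (f x == 0).
have EA : E :\: D = ~: (D :|: A).
  apply/setP=> x; rewrite !inE memD F2_addr_eq0.
  by case: (f x == 0); case: (B b x == 0).
(* Together these counts give |E| = |V| - |D| - |A| + 2 |D :&: A|, which is solved for the last
   term. *)
have := cardsID D E; rewrite ED EA.
have := cardsC (D :|: A); have := cardsUI D A; have := cardDq.
move: cA cE; rewrite cardV; case: (f b == 0); nia.
Qed.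

Lemma wt_word b c :
  wt (word b c) = #|[set x in D | B b x + c != 0]|.
Proof.
rewrite /wt -(card_imset _ pt_inj); apply: eq_card => x; apply/imsetP/idP.
  by case=> j; rewrite !inE mxE => Bj ->; rewrite enum_valP.
rewrite inE memD => /andP[/eqP fx Bx]; have [j jx] := pt_onto fx.
by exists j; rewrite ?inE ?mxE ?jx.
Qed.

(** For [c = 0] the weight counts the points of [D] off the hyperplane of [b], for [c = 1] those on
    it. *)
Lemma wt_word_nz b c : b != 0 ->
  wt (word b c) = (if (f b == 0%R) == (c == 0%R) then q * q else q * (q - 1))%N.
Proof.
move=> b0; rewrite wt_word.
have := cardsID [set x | B b x == 0] D; rewrite card_quadric_hyperplane //.
have [->|->] := F2P c; rewrite ?eqxx ?oner_eq0.
  have -> : [set x in D | B b x + 0 != 0] = D :\: [set x | B b x == 0].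
    by apply/setP=> x; rewrite !inE addr0 andbC.
  by have := cardDq; case: (f b == 0) => /=; nia.
move=> _; rewrite -[RHS]if_neg.
have -> : [set x in D | B b x + 1 != 0] = D :&: [set x | B b x == 0].
  by apply/setP=> x; rewrite !inE F2_addr_eq0 oner_eq0; case: (B b x == 0).
by rewrite card_quadric_hyperplane //; case: (f b == 0).
Qed.

Lemma wt_word0 : wt (word 0 1) = #|D|.
Proof.
rewrite wt_word; apply: eq_card => x.
by rewrite inE (pairing0l BDl) add0r oner_eq0 andbT.
Qed.

Lemma qcode_wt y : y \in qcode -> y != 0 -> (q * (q - 1) <= wt y)%N.
Proof.
move=> /pcodeP[b [c ->]]; have [->|b0] := eqVneq b 0.
  have [->|->] := F2P c => [/eqP[]|_].
    by apply/rowP=> j; rewrite !mxE (pairing0l BDl) addr0.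
  by rewrite wt_word0; have := cardDq; nia.
by move=> _; rewrite wt_word_nz //; case: ifP => _; nia.
Qed.

Lemma is_lin_qcode : is_lin qcode.
Proof. exact: is_lin_pcode. Qed.

(** The parametrization is injective because every nonzero pair [(b, c)] gives a word of positive
    weight. *)
Lemma card_qcode : #|qcode| = (#|V| * 2)%N.
Proof.
apply: card_pcode => // b c bc0.
have wt0 : wt (word b c) = 0%N.
  by rewrite /word bc0 /wt; apply: eq_card0 => j; rewrite inE mxE eqxx.
have [b0|b0] := eqVneq b 0.
  split=> //; have [//|c1] := F2P c.
  by move: wt0; rewrite b0 c1 wt_word0; have := cardDq; nia.
by move: wt0; rewrite wt_word_nz //; case: ifP => _; nia.
Qed.

Lemma qcode_cover (i : 'I_#|D|) :
  exists y, [/\ y \in qcode, y 0 i != 0 & wt y = (q * (q - 1))%N].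
Proof.
(* With [b] the sum of [pt i] and another point of [D], [B b (pt i) = f b]; then [c = f b + 1] gives
   value 1 at [i] and selects the smaller weight. *)
have [|z Dz] := @card_ltn_ex _ D [set pt i].
  by rewrite cards1; have := cardDq; nia.
rewrite inE => zi; pose b := pt i + z.
have b0 : b != 0.
  by apply: contraNneq zi => /(congr1 (+%R (pt i))); rewrite addKV addr0 => ->.
have Bb : B b (pt i) = f b.
  rewrite BDl Bxx add0r fD fpt add0r BC.
  by move: Dz; rewrite memD => /eqP->; rewrite add0r.
exists (word b (f b + 1)); split; first by apply/pcodeP; exists b, (f b + 1).
  by rewrite mxE Bb addrA F2_addxx add0r oner_eq0.
by rewrite wt_word_nz // F2_addr_eq0 oner_eq0; case: (f b == 0).
Qed.

Lemma dual_qcode_wt y : y \in dual qcode -> y != 0 -> (4 <= wt y)%N.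
Proof. exact: dual_pcode_wt. Qed.

Lemma dual_qcode_cover (i : 'I_#|D|) :
  exists y, [/\ y \in dual qcode, y 0 i != 0 & wt y = 4%N].
Proof.
apply: dual_pcode_cover => // {}i.
have [|y Dy] := @card_ltn_ex _ D [set pt i].
  by rewrite cards1; have := cardDq; nia.
rewrite inE => yi; pose b := pt i + y.
have b0 : b != 0.
  by apply: contraNneq yi => /(congr1 (+%R (pt i))); rewrite addKV addr0 => ->.
(* For [z] in [D], [f (pt i + y + z)] equals [B b z + B b (pt i)]. So the fourth point lies in [D]
   when [z] is on the same side of the hyperplane as [pt i], and [A] collects these [z]. *)
pose A := if B b (pt i) == 0 then D :&: [set x | B b x == 0]
          else D :\: [set x | B b x == 0].
have AP x : x \in A -> f x = 0 /\ B b x = B b (pt i).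
  rewrite /A; have [->|->] := F2P (B b (pt i)); rewrite ?eqxx ?oner_eq0 !inE memD.
    by move=> /andP[/eqP-> /eqP->].
  by move=> /andP[Bx /eqP->]; rewrite [B b x]F2E Bx.
have cA : (2 < #|A|)%N.
  have := card_quadric_hyperplane b0; have := cardsID [set x | B b x == 0] D.
  have := cardDq; rewrite /A.
  by case: (B b (pt i) == 0); case: (f b == 0) => /=; nia.
have [|z Az] := @card_ltn_ex _ A [set pt i; y].
  by apply: leq_ltn_trans cA; rewrite cards2; case: (_ != _).
rewrite !inE negb_or => /andP[zi zy]; have [fz Bz] := AP z Az.
have fy : f y = 0 by apply/eqP; rewrite -memD.
have [j jy] := pt_onto fy; have [k kz] := pt_onto fz.
exists j, k; split.
- by apply: contraNneq yi => ->; rewrite jy.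
- by apply: contraNneq zi => ->; rewrite kz.
- by apply: contraNneq zy => jk; rewrite -kz -jk jy.
apply: pt_onto; rewrite jy kz !fD fpt fy fz !add0r addr0 -/b Bz.
by rewrite BDl Bxx add0r BC F2_addxx.
Qed.

End QuadraticForm.

(** * The trace and norm forms on the field of order 2^(2r) *)

Section TraceForm.
Local Open Scope ring_scope.
Variables (F : finFieldType) (r : nat).
Hypothesis r_gt0 : (0 < r)%N.
Hypothesis cardF : #|F| = (2 ^ (2 * r))%N.

Let char2 : 2 \in [pchar F].
Proof. exact: card_finPcharP cardF isT. Qed.

Let powD i (x y : F) : (x + y) ^+ (2 ^ i) = x ^+ (2 ^ i) + y ^+ (2 ^ i).
Proof. by rewrite exprDn_pchar // pnatX (pnatE _ (isT : prime 2)) char2. Qed.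

Let frobK (x : F) : (x ^+ (2 ^ r)) ^+ (2 ^ r) = x.
Proof. by rewrite -exprM -expnD addnn -mul2n -cardF expf_card. Qed.

Lemma Tr2D s (x y : F) : Tr2 s (x + y) = Tr2 s x + Tr2 s y.
Proof. by rewrite -big_split; apply: eq_bigr => i _; apply: powD. Qed.

(** Squaring permutes the summands cyclically, so the trace is a root of T^2 = T. *)
Lemma Tr2_bool s (x : F) : x ^+ (2 ^ s) = x -> Tr2 s x = 0 \/ Tr2 s x = 1.
Proof.
move=> xs; have : Tr2 s x ^+ 2 = Tr2 s x.
  have sq0 : (0 : F) ^+ 2 = 0 by rewrite expr0n.
  rewrite /Tr2 (big_morph (fun x => x ^+ 2) (powD 1) sq0).
  case: s xs => [|s] xs; first by rewrite !big_ord0.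
  rewrite big_ord_recr big_ord_recl /= -exprM -expnSr xs addrC expn0 expr1.
  by congr (_ + _); apply: eq_bigr => i _; rewrite -exprM -expnSr.
move=> /eqP; rewrite -subr_eq0 expr2 -[X in _ - X]mulr1 -mulrBr mulf_eq0 subr_eq0.
by case/orP=> /eqP; [left | right].
Qed.

(** [toF2] merely tests for being nonzero, so additivity is stated for the values 0 and 1. *)
Lemma toF2D (a b : F) :
  a = 0 \/ a = 1 -> b = 0 \/ b = 1 -> toF2 (a + b) = toF2 a + toF2 b.
Proof.
rewrite /toF2 => -[]-> []->;
  rewrite ?(addrr_pchar2 char2) ?addr0 ?add0r ?eqxx ?oner_eq0 /=;
  by rewrite ?addr0 ?add0r // F2_addxx.
Qed.

Lemma toF2_eq0 (a : F) : (toF2 a == 0) = (a == 0).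
Proof. by rewrite /toF2; case: (a == 0). Qed.

Let TrF (x : F) : Tr2 (2 * r) x = 0 \/ Tr2 (2 * r) x = 1.
Proof. by apply: Tr2_bool; rewrite -cardF expf_card. Qed.

Let norm_fix (x : F) : (x ^+ (2 ^ r + 1)) ^+ (2 ^ r) = x ^+ (2 ^ r + 1).
Proof. by rewrite exprD expr1 exprMn frobK mulrC. Qed.

Let TrN (x : F) : Tr2 r (x ^+ (2 ^ r + 1)) = 0 \/ Tr2 r (x ^+ (2 ^ r + 1)) = 1.
Proof. exact: Tr2_bool. Qed.

Lemma card_roots (P : {poly F}) (A : {set F}) :
  P != 0 -> (forall x, x \in A -> P.[x] = 0) -> (#|A| < size P)%N.
Proof.
move=> P0 AP; rewrite cardE; apply: max_poly_roots => //; last exact: enum_uniq.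
by apply/allP=> x; rewrite mem_enum => /AP Px; apply/rootP.
Qed.

(** Dividing the trace of x^e by x^e lowers the degree to e(2^(s-1) - 1) and leaves constant term 1,
    so the polynomial is nonzero. *)
Lemma card_trace_kernel e s : (0 < e)%N -> (0 < s)%N ->
  (#|[set x : F | (x != 0%R) && (Tr2 s (x ^+ e) == 0%R)]| <= e * (2 ^ s.-1 - 1))%N.
Proof.
move=> e0 s0; pose P : {poly F} := \sum_(i < s) 'X^(e * (2 ^ i - 1)).
have P0 : P != 0.
  suff P01 : P.[0] = 1.
    by apply/eqP=> P0; move: P01; rewrite P0 horner0 => /eqP; rewrite eq_sym oner_eq0.
  rewrite /P horner_sum -(prednK s0) big_ord_recl big1 => [|i _].
    by rewrite hornerXn muln0 addr0.
  rewrite hornerXn expr0n; case: eqP => // /eqP; rewrite muln_eq0 subn_eq0.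
  by rewrite -(expn0 2) leq_exp2l // (gtn_eqF e0).
rewrite -ltnS; apply: leq_trans (_ : (size P <= _)%N); last first.
  apply: leq_trans (size_sum _ _ _) _; apply/bigmax_leqP=> i _.
  rewrite size_polyXn ltnS leq_mul2l leq_sub2r ?orbT // leq_exp2l //.
  by have := ltn_ord i; lia.
apply: card_roots => // x; rewrite inE => /andP[x0 /eqP Tx].
have xe0 : x ^+ e != 0 by rewrite expf_neq0.
apply: (mulfI xe0); rewrite mulr0 -[RHS]Tx horner_sum mulr_sumr.
apply: eq_bigr => i _; rewrite hornerXn exprM -exprS.
by rewrite subn1 prednK ?expn_gt0.
Qed.

(** The trace of x^e minus 1 is a polynomial in x of degree at most e 2^(s-1), nonzero because its
    value at 0 is -1. *)
Lemma card_trace_one e s : (0 < e)%N ->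
  (#|[set x : F | Tr2 s (x ^+ e) == 1%R]| <= e * 2 ^ s.-1)%N.
Proof.
move=> e0; pose P : {poly F} := \sum_(i < s) 'X^(e * 2 ^ i) - 1.
have P0 : P != 0.
  suff P01 : P.[0] = - 1.
    by apply/eqP=> P0; move: P01; rewrite P0 horner0 => /eqP;
      rewrite eq_sym oppr_eq0 oner_eq0.
  rewrite /P hornerD hornerN hornerC horner_sum big1 ?add0r // => i _.
  by rewrite hornerXn expr0n muln_eq0 expn_eq0 (gtn_eqF e0).
rewrite -ltnS; apply: leq_trans (_ : (size P <= _)%N); last first.
  apply: leq_trans (size_polyD _ _) _; rewrite size_polyN size_poly1 geq_max ltnS leq0n andbT.
  apply: leq_trans (size_sum _ _ _) _; apply/bigmax_leqP=> i _.
  rewrite size_polyXn ltnS leq_mul2l leq_exp2l ?orbT //.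
  by have := ltn_ord i; lia.
apply: card_roots => // x; rewrite inE => /eqP Tx.
rewrite hornerD hornerN hornerC -[X in _ - X]Tx horner_sum.
by apply/eqP; rewrite subr_eq0; apply/eqP/eq_bigr => i _; rewrite hornerXn exprM.
Qed.

Let e2r : (2 ^ r = 2 * 2 ^ (r - 1))%N.
Proof. by rewrite -expnS; congr expn; lia. Qed.

Let cardFq : #|F| = (4 * (2 ^ (r - 1) * 2 ^ (r - 1)))%N.
Proof. by rewrite cardF mul2n -addnn expnD e2r; nia. Qed.

(* Both root counts are attained because the two bounds add up to the number
   of nonzero elements of F. *)
Lemma card_Dset : #|Dset F r| = (2 ^ (r - 1) * (2 * 2 ^ (r - 1) - 1))%N.
Proof.
have D0 : 0 \in Dset F r.
  rewrite inE /Tr2 big1 // => i _; rewrite -exprM expr0n.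
  by rewrite muln_eq0 expn_eq0 addn1.
have e0 : (0 < 2 ^ r + 1)%N by rewrite addn1.
have := card_trace_kernel e0 r_gt0; have := card_trace_one r e0.
rewrite (_ : [set x | _ && _] = Dset F r :\ 0); last first.
  by apply/setP=> x; rewrite !inE.
rewrite (_ : [set x | _ ] = ~: Dset F r); last first.
  by apply/setP=> x; rewrite !inE; case: (TrN x) => ->;
    rewrite ?eqxx ?oner_eq0 // eq_sym oner_eq0.
have := cardsC (Dset F r); rewrite (cardsD1 0) D0 cardFq -subn1 e2r.
have : (0 < 2 ^ (r - 1))%N by rewrite expn_gt0.
move: (2 ^ (r - 1))%N #|_ :\ _| #|~: _| => [//|q] d c _ /=.
have -> : (2 * q.+1 - 1 = 2 * q + 1)%N by lia.
rewrite subn1 /=; nia.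
Qed.

(** For nonzero [x] the products [b * x] fill [F], so the trace would vanish at more nonzero points
    than [card_trace_kernel] allows. *)
Lemma trace_nondeg (x : F) : (forall b, Tr2 (2 * r) (b * x) = 0) -> x = 0.
Proof.
move=> Tx; apply/eqP/negPn/negP=> x0.
have r2 : (0 < 2 * r)%N by lia.
have := card_trace_kernel (isT : (0 < 1)%N) r2.
rewrite (_ : [set y : F | _] = ~: [set 0]); last first.
  apply/setP=> y; rewrite !inE expr1; case: (y != 0) => //=.
  by rewrite -(divfK x0 y) Tx eqxx.
rewrite cardsC1 cardF -{1}(prednK r2) expnS mul1n.
have : (0 < 2 ^ (2 * r).-1)%N by rewrite expn_gt0.
by move: (2 ^ _)%N => k; lia.
Qed.

(** The twist by the power 2^r makes this the polarization of [norm_form], which is the trace of the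
    norm to the subfield of order 2^r. *)
Definition trace_form (x y : F) : 'F_2 := toF2 (Tr2 (2 * r) (x ^+ (2 ^ r) * y)).
Definition norm_form (x : F) : 'F_2 := toF2 (Tr2 r (x ^+ (2 ^ r + 1))).

Lemma trace_formDl x x' y : trace_form (x + x') y = trace_form x y + trace_form x' y.
Proof. by rewrite /trace_form powD mulrDl Tr2D toF2D. Qed.

(** Transitivity of the trace through the subfield of order 2^r. *)
Lemma Tr2_double (z : F) : Tr2 (2 * r) z = Tr2 r (z + z ^+ (2 ^ r)).
Proof.
rewrite Tr2D /Tr2 mul2n -addnn big_split_ord /=; congr (_ + _).
by apply: eq_bigr => i _; rewrite expnD exprM.
Qed.

Lemma norm_formD x y : norm_form (x + y) = norm_form x + norm_form y + trace_form x y.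
Proof.
rewrite /norm_form /trace_form -!toF2D //; last first.
  by rewrite -Tr2D; case: (TrN x) (TrN y) => + []; rewrite Tr2D => -> ->;
    rewrite ?addr0 ?add0r ?addrr_pchar2 //; [left | right | right | left].
(* The cross terms of the norm of x + y are z and z^(2^r) with z = x^(2^r) y. *)
rewrite Tr2_double -!Tr2D exprMn frobK !exprD !expr1 powD.
by rewrite mulrDl !mulrDr [x * _]mulrC; congr (toF2 (Tr2 _ _)); rewrite -!addrA;
  congr (_ + _); rewrite addrC -!addrA addrC -addrA [X in _ + X]addrC.
Qed.

Lemma trace_form_nondeg x : (forall y, trace_form x y = 0) -> x = 0.
Proof.
move=> Tx; rewrite -(frobK x) (trace_nondeg (x := x ^+ (2 ^ r))) ?expr0n ?expn_eq0 //.
by move=> b; apply/eqP; rewrite mulrC -toF2_eq0; apply/eqP/Tx.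
Qed.

Lemma mem_Dset x : (x \in Dset F r) = (norm_form x == 0).
Proof. by rewrite inE toF2_eq0. Qed.

(** Raising to the power 2^r is an involution of [F], so it only reparametrizes the codewords. *)
Lemma codeCD_qcode : codeCD F r = qcode trace_form (Dset F r).
Proof.
apply/setP=> w; apply/imset2P/imset2P=> -[b c _ _ ->].
  by exists (b ^+ (2 ^ r)) c => //; apply/rowP=> j; rewrite !mxE /trace_form frobK.
by exists (b ^+ (2 ^ r)) c.
Qed.

End TraceForm.

(** * The Cadambe-Mazumdar bound and the final assembly *)

Lemma almost_k_optimal_quadric r : 3 <= r ->
  let q := 2 ^ (r - 1) in
  almost_k_optimal 'F_2 (q * (2 * q - 1)) (q * (2 * q - 1) - 2 * r - 1) 4
    (q * (q - 1) - 1).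
Proof.
move=> hr q; have q4 : 4 <= q.
  by rewrite -[4]/(2 ^ 2) leq_exp2l // leq_subRL; lia.
have r_lt_q : r - 1 < q by apply: ltn_expl.
have qq : 2 ^ (2 * r - 2) = q * q by rewrite -expnD; congr expn; lia.
have r2_lt_qq : 2 * r - 2 < q * q by rewrite -qq; apply: ltn_expl.
have ub1 := kopt4_leq (2 * r - 2); have lb1 : 2 <= 2 * r - 2 by lia.
move/kopt4_geq: lb1 => lb1; rewrite qq in ub1 lb1.
have lb2 : q - (r - 1) - 1 <= kopt 'F_2 q 4 by apply: kopt4_geq; lia.
have q4X : 4 * q <= q * q by rewrite leq_mul2r q4 orbT.
have eN : q * (2 * q - 1) + q = 2 * (q * q) by nia.
have eM : q * (q - 1) + q = q * q by nia.
(* The products become atoms tied by linear relations, which leaves only linear arithmetic. *)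
move: (q * (2 * q - 1)) (q * (q - 1)) (q * q) eN eM q4X r2_lt_qq ub1 lb1 {qq}.
move=> N M X eN eM q4X r2_lt_X ub1 lb1; clearbody q.
have term1 : CM_term 'F_2 N 4 (M - 1) 1 = (N - 2 * r - 1).+1.
  by rewrite /CM_term (_ : N - 1 * (M - 1 + 1) = X); lia.
split; last by exists 1.
case=> [//|[|[|t]]] _; first by rewrite term1.
  (* For t = 2 the remaining length is [q], and an extended Hamming code of that length suffices. *)
  by rewrite /CM_term (_ : N - 2 * (M - 1 + 1) = q); lia.
(* For t >= 3 the summand from the locality alone is large enough. *)
apply: (@leq_trans ((M - 1) * 3)); first by lia.
by apply: leq_trans (leq_addr _ _); rewrite leq_mul2l orbC.
Qed.

Theorem theorem3p10 (r : nat) (hr : (3 <= r)%N) (F : finFieldType)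
    (hF : #|F| = (2 ^ (2 * r))%N) :
  let n := (2 ^ (r - 1) * (2 ^ r - 1))%N in
  [/\ #|Dset F r| = n,
      is_LRC (codeCD F r) (2 * r + 1) (2 ^ (r - 1) * (2 ^ (r - 1) - 1)) 2 3,
      is_LRC (dual (codeCD F r)) (n - 2 * r - 1) 4 2
             (2 ^ (r - 1) * (2 ^ (r - 1) - 1) - 1) &
      k_optimal 'F_2 #|Dset F r| (n - 2 * r - 1) 4
                (2 ^ (r - 1) * (2 ^ (r - 1) - 1) - 1)
      \/ almost_k_optimal 'F_2 #|Dset F r| (n - 2 * r - 1) 4
                (2 ^ (r - 1) * (2 ^ (r - 1) - 1) - 1)]%N.
Proof.
move=> n; pose q := (2 ^ (r - 1))%N.
have r0 : (0 < r)%N by lia.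
have e2r : (2 ^ r = 2 * q)%N by rewrite -expnS; congr expn; lia.
have q4 : (4 <= q)%N by rewrite -[4]/(2 ^ 2)%N leq_exp2l //; lia.
have r_lt_q : (r - 1 < q)%N by apply: ltn_expl.
have cD : #|Dset F r| = n by rewrite card_Dset // /n e2r.
have cF : #|F| = (4 * (q * q))%N.
  by rewrite hF mul2n -addnn expnD e2r; lia.
have D0 : (0 < #|Dset F r|)%N by rewrite cD /n e2r -/q; nia.
have fD := norm_formD hF; have BDl := trace_formDl hF.
have B_nd := trace_form_nondeg r0 hF; have memD := @mem_Dset F r.
have cDq := card_Dset r0 hF.
rewrite codeCD_qcode //.
have lin := is_lin_qcode BDl (Dset F r).
have dist := qcode_wt fD BDl B_nd memD q4 cF cDq.
have cover := qcode_cover fD BDl B_nd memD q4 cF cDq.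
have ddist := dual_qcode_wt fD BDl B_nd (D := Dset F r).
have dcover := dual_qcode_cover fD BDl B_nd memD q4 cF cDq.
have dim : dimC (qcode (trace_form r) (Dset F r)) = (2 * r + 1)%N.
  apply/eqP; rewrite -(@eqn_exp2l 2) // -{1}(card_Fp (isT : prime 2)).
  by rewrite -card_lin // (card_qcode fD BDl B_nd memD q4 cF cDq) hF addn1 expnSr.
have F2 : #|'F_2%type| = 2 by rewrite card_Fp.
(* The roles cross: distance 4 of the dual gives locality 3 of the code, and by [dualK] the distance
   of the code gives the locality of the dual. *)
have qcode_loc := locality_dual_dist D0 lin ddist dcover.
have dual_loc : locality (dual (qcode (trace_form r) (Dset F r))) (q * (q - 1) - 1).
  by rewrite subn1; apply: locality_dual_dist; rewrite ?is_lin_dual ?dualK.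
split=> //.
- by split=> //; apply: has_min_dist_cover.
- split; rewrite ?is_lin_dual ?dimC_dual ?dim ?cD ?subnDA //.
  exact: has_min_dist_cover.
- right; rewrite cD /n e2r; exact: almost_k_optimal_quadric.
Qed.
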